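(* Let $B(t,x;132)=\sum_{n=0}^{\infty}\sum_{\pi\in\mathfrak{S}_n(132)}t^{\mathrm{bdes}(\pi)}x^n$. Then $$B(t,x;132)=\frac{1-2(1-t)x+(1-t)(1-2t)x^{2}-\sqrt{1-4x+6(1-t)x^{2}-4(1-t)^{2}x^{3}+(1-t)^{2}x^{4}}}{2tx\,(1-(1-t)x)}.$$
   Context: $\mathfrak{S}_n$ is the set of permutations $\pi=\pi_1\pi_2\cdots\pi_n$ of $[n]=\{1,\dots,n\}$ in one-line notation ($\mathfrak{S}_0$ consists of the empty permutation). $\mathfrak{S}_n(132)$ is the set of $\pi\in\mathfrak{S}_n$ having no length-three subsequence with the same relative order as $132$. An index $k\in[n-1]$ is a big descent of $\pi\in\mathfrak{S}_n$ if $\pi_k>\pi_{k+1}+1$; $\mathrm{bdes}(\pi)$ is the number of big descents of $\pi$. The identity is one of formal power series in $x$ (with coefficients in $\mathbb{Q}(t)$), the square root denoting the formal power series in $x$ with constant term $1$ whose square is the radicand. *)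

(* Defs.v *)
From HB Require Import structures.
From mathcomp Require Import all_boot all_fingroup all_algebra.
From mathcomp Require Import boolp classical_sets.

Set Implicit Arguments.
Unset Strict Implicit.
Unset Printing Implicit Defensive.

Import GRing.Theory.
Local Open Scope ring_scope.

(* Formal power series in one variable.  The coefficient sequence is wrapped
   in a record because mathcomp.classical.functions gives nat -> R the
   pointwise product, whereas the product here is the Cauchy product. *)
Record fps (R : Type) := Fps { fps_coef :> nat -> R }.

Lemma fpsP (R : Type) (f g : fps R) : f =1 g <-> f = g.
Proof.
split=> [|-> //]; case: f => f; case: g => g /= fg.
by congr Fps; apply: funext.
Qed.

HB.instance Definition _ (R : Type) := gen_eqMixin (fps R).
HB.instance Definition _ (R : Type) := gen_choiceMixin (fps R).

Section FpsZmod.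
Variable R : zmodType.
Implicit Types f g h : fps R.

Definition fps_zero : fps R := Fps (fun _ => 0).
Definition fps_opp f : fps R := Fps (fun n => - f n).
Definition fps_add f g : fps R := Fps (fun n => f n + g n).

Fact fps_addA : associative fps_add.
Proof. by move=> f g h; apply/fpsP => n /=; rewrite addrA. Qed.
Fact fps_addC : commutative fps_add.
Proof. by move=> f g; apply/fpsP => n /=; rewrite addrC. Qed.
Fact fps_add0 : left_id fps_zero fps_add.
Proof. by move=> f; apply/fpsP => n /=; rewrite add0r. Qed.
Fact fps_addN : left_inverse fps_zero fps_opp fps_add.
Proof. by move=> f; apply/fpsP => n /=; rewrite addNr. Qed.

HB.instance Definition _ :=
  GRing.isZmodule.Build (fps R) fps_addA fps_addC fps_add0 fps_addN.

Lemma fps_coef0 n : (0 : fps R) n = 0. Proof. by []. Qed.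
Lemma fps_coefN f n : (- f) n = - f n. Proof. by []. Qed.
Lemma fps_coefD f g n : (f + g) n = f n + g n. Proof. by []. Qed.
Lemma fps_coefB f g n : (f - g) n = f n - g n. Proof. by []. Qed.

End FpsZmod.

(* The constant series c and the variable x. *)
Definition fpsC (R : nzRingType) (c : R) : fps R :=
  Fps (fun n => if n == 0%N then c else 0).
Definition fpsX (R : nzRingType) : fps R := Fps (fun n => (n == 1%N)%:R).

Section FpsRing.
Variable R : comNzRingType.
Implicit Types f g h : fps R.

Definition fps_mul f g : fps R :=
  Fps (fun n => \sum_(i < n.+1) f i * g (n - i)%N).

Fact fps_mulC : commutative fps_mul.
Proof.
move=> f g; apply/fpsP => n /=; rewrite (reindex_inj rev_ord_inj) /=.
by apply: eq_bigr => j _; rewrite mulrC (sub_ordK j).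
Qed.

Let mul_rev f g n : fps_mul f g n = \sum_(i < n.+1) f (n - i)%N * g i.
Proof. by rewrite fps_mulC; apply: eq_bigr => j _; rewrite mulrC. Qed.

Fact fps_mulA : associative fps_mul.
Proof.
move=> f g h; apply/fpsP => n; rewrite [RHS]mul_rev /=.
pose coef3 j k := f j * (g (n - j - k)%N * h k).
transitivity (\sum_(j < n.+1) \sum_(k < n.+1 | (k <= n - j)%N) coef3 j k).
  apply: eq_bigr => /= j _; rewrite [X in _ * X](mul_rev g h) big_distrr /=.
  by rewrite (big_ord_narrow_leq (leq_subr _ _)).
rewrite (exchange_big_dep predT) //=; apply: eq_bigr => k _.
transitivity (\sum_(j < n.+1 | (j <= n - k)%N) coef3 j k).
  apply: eq_bigl => j; rewrite -ltnS -(ltnS j) -!subSn ?leq_ord //.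
  by rewrite -subn_gt0 -(subn_gt0 j) -!subnDA addnC.
rewrite (big_ord_narrow_leq (leq_subr _ _)) big_distrl /=.
by apply: eq_bigr => j _; rewrite /coef3 -!subnDA addnC mulrA.
Qed.

Fact fps_mul1 : left_id (fpsC 1) fps_mul.
Proof.
move=> f; apply/fpsP => n /=; rewrite big_ord_recl /= subn0 mul1r.
by rewrite big1 ?addr0 // => j _; rewrite mul0r.
Qed.

Fact fps_mulDl : left_distributive fps_mul (@fps_add R).
Proof.
move=> f g h; apply/fpsP => n /=; rewrite -big_split.
by apply: eq_bigr => j _; rewrite mulrDl.
Qed.

Fact fps1_neq0 : fpsC 1 != 0 :> fps R.
Proof.
by apply/eqP => /fpsP /(_ 0%N) /= /eqP; rewrite oner_eq0.
Qed.

HB.instance Definition _ := GRing.Zmodule_isComNzRing.Build (fps R)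
  fps_mulA fps_mulC fps_mul1 fps_mulDl fps1_neq0.

Lemma fps_coef1 n : (1 : fps R) n = (n == 0%N)%:R.
Proof. by rewrite {1}/GRing.one /=; case: (n == 0%N). Qed.

Lemma fps_coefM f g n : (f * g) n = \sum_(i < n.+1) f i * g (n - i)%N.
Proof. by []. Qed.

Lemma fps_coef0M f g : (f * g) 0%N = f 0%N * g 0%N.
Proof. by rewrite fps_coefM big_ord1. Qed.

Definition fps_unit : {pred fps R} := [pred f | `[< exists g, g * f = 1 >]].
Definition fps_inv f : fps R :=
  if pselect (exists g, g * f = 1) is left e then sval (cid e) else f.

Fact fps_mulVf : {in fps_unit, left_inverse 1 fps_inv *%R}.
Proof.
move=> f /asboolP f_unit; rewrite /fps_inv; case: pselect => // e.
exact: (svalP (cid e)).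
Qed.

Fact fps_unitPl f g : g * f = 1 -> f \in fps_unit.
Proof. by move=> gf; apply/asboolP; exists g. Qed.

Fact fps_inv_out : {in [predC fps_unit], fps_inv =1 id}.
Proof. by move=> f /asboolP nf; rewrite /fps_inv; case: pselect. Qed.

HB.instance Definition _ := GRing.ComNzRing_hasMulInverse.Build (fps R)
  fps_mulVf fps_unitPl fps_inv_out.

End FpsRing.

Section FpsIdomain.
Variable R : idomainType.

Fact fps_idomain : GRing.integral_domain_axiom (fps R).
Proof.
have ord (f : fps R) : f != 0 ->
    exists m, f m != 0 /\ forall i, (i < m)%N -> f i = 0.
  move=> f0; have exf : exists m, f m != 0.
    apply: contrapT => /forallNP fN; case/eqP: f0; apply/fpsP => n.
    by apply: contrapT => /eqP /fN.
  exists (ex_minn exf); case: ex_minnP => m fm min; split=> // i ltim.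
  by apply: contraTeq ltim => fi; rewrite -leqNgt min.
move=> f g fg0; apply: contraT; rewrite negb_or.
case/andP => /ord[m [fm f0]] /ord[n [gn g0]].
move/fpsP: fg0 => /(_ (m + n)%N); rewrite fps_coefM fps_coef0.
have ltm : (m < (m + n).+1)%N by rewrite ltnS leq_addr.
rewrite (bigD1 (Ordinal ltm)) //= big1 ?addr0 => [|i neq_im].
  by move/eqP; rewrite addKn mulf_eq0 (negPf fm) (negPf gn).
have [ltim|ltmi|eqim] := ltngtP i m.
- by rewrite f0 ?mul0r.
- by rewrite g0 ?mulr0 // ltn_subLR ?ltn_add2r // -ltnS ltn_ord.
- by case/eqP: neq_im; apply: val_inj.
Qed.

HB.instance Definition _ :=
  GRing.ComUnitRing_isIntegral.Build (fps R) fps_idomain.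

End FpsIdomain.

(* The power series with constant term 1 whose square is f; existence and
   uniqueness (when f 0 = 1 and 2 is invertible) are [fps_sqrtP] and
   [fps_sqrt_uniq] below.  When there is no such series the value is 0. *)
Definition fps_sqrt (R : comNzRingType) (f : fps R) : fps R :=
  xget 0 [set s : fps R | s 0%N = 1 /\ s ^+ 2 = f]%classic.

Section FpsSqrt.
Variable F : fieldType.
Hypothesis two_neq0 : 2%:R != 0 :> F.
Implicit Types f s : fps F.

Lemma fps_sqrt_exists f : f 0%N = 1 -> exists s, s 0%N = 1 /\ s ^+ 2 = f.
Proof.
move=> f0.
pose next n (p : nat -> F) :=
  (f n.+1 - \sum_(i < n) p i.+1 * p (n - i)%N) / 2%:R.
pose approx := fix approx n : nat -> F := if n is m.+1 then
  fun k => if k == m.+1 then next m (approx m) else approx m k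
  else fun=> 1.
have apE n k : (k <= n)%N -> approx n k = approx k k.
  elim: n => [|n IHn]; first by rewrite leqn0 => /eqP ->.
  rewrite leq_eqVlt => /orP[/eqP -> //|]; rewrite ltnS => lekn /=.
  by rewrite ltn_eqF ?ltnS // IHn.
pose s := Fps (fun n => approx n n); exists s; split=> //.
apply/fpsP => -[|n]; first by rewrite expr2 fps_coef0M mulr1 f0.
rewrite expr2 fps_coefM big_ord_recl big_ord_recr /= subn0 !subnn.
rewrite eqxx mul1r mulr1 /next.
under eq_bigr => i _ do
  rewrite /bump add1n subSS -/(approx i.+1 i.+1).
set S1 := \sum_(i < n) _; set S2 := \sum_(i < n) _.
have -> : S1 = S2.
  apply: eq_bigr => i _; rewrite [RHS]mulrC [LHS]mulrC.
  by congr (_ * _); [rewrite apE ?leq_subr | rewrite (apE n i.+1)].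
rewrite addrCA -mulrDl -mulr2n -[_ *+ 2]mulr_natr mulfK //.
by rewrite addrC subrK.
Qed.

Lemma fps_sqrt_unique s1 s2 :
  s1 0%N = 1 -> s2 0%N = 1 -> s1 ^+ 2 = s2 ^+ 2 -> s1 = s2.
Proof.
move=> s10 s20 /eqP; rewrite eqf_sqr => /orP[/eqP //|/eqP /fpsP /(_ 0%N)].
move/eqP; rewrite fps_coefN s10 s20 -addr_eq0 -mulr2n.
by rewrite (negPf two_neq0).
Qed.

Lemma fps_sqrtP f :
  f 0%N = 1 -> fps_sqrt f 0%N = 1 /\ fps_sqrt f ^+ 2 = f.
Proof. by move=> /fps_sqrt_exists /(xgetPex 0). Qed.

Lemma fps_sqrt_uniq f s : s 0%N = 1 -> s ^+ 2 = f -> fps_sqrt f = s.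
Proof.
move=> s0 sf; apply: xget_unique => // r [r0 rf].
by apply: fps_sqrt_unique => //; rewrite rf.
Qed.

End FpsSqrt.

(* A permutation of [n] is represented by s : 'S_n; positions and values are
   both shifted down by 1, which affects neither notion below. *)
Definition avoids132 (n : nat) (s : 'S_n) : bool :=
  ~~ [exists i : 'I_n, exists j : 'I_n, exists k : 'I_n,
        (i < j < k)%N && (s i < s k < s j)%N].

(* The witness k' is the position k + 1, so k is never the last position. *)
Definition bdes (n : nat) (s : 'S_n) : nat :=
  #|[set k : 'I_n | [exists k' : 'I_n,
        (k' == k.+1 :> nat) && ((s k').+1 < s k)%N]]|.

(* Q(t) and its generator t. *)
Definition Qt : fieldType := {fraction {poly rat}}.
Definition Qt_t : Qt := tofrac ('X : {poly rat}).

Definition B132 : fps Qt :=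
  Fps (fun n => \sum_(s : 'S_n | avoids132 s) Qt_t ^+ bdes s).

(* Main.v *)
Require Import Defs.
From mathcomp Require Import all_boot all_algebra.
From mathcomp Require Import perm ring.

(** A nonempty 132-avoiding permutation of [n+1] factors as [L (n+1) R] with
    every letter of [L] above every letter of [R], both factors 132-avoiding.
    The big descents are those of [L] and [R], plus the step from [n+1] to [R],
    except when [R] is empty, or [L] is empty and [R] starts with its maximum.
    Let [G] count the words [n w], with [n] prepended as a new maximum to a
    132-avoiding word [w] on [n] letters; then, with
    [S = (B - 1)(1 + t(B - 1))] collecting the factorisations where [L] is
    nonempty, [B = 1 + x(G + S)] and [G = 1 + x(G + tS)].  Eliminating [G]
    gives a quadratic equation for [B], solved by the stated formula. *)

Import GRing.Theory.
Local Open Scope ring_scope.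

(** * Pattern avoidance and big descents on words *)

Fixpoint wavoids132 (w : seq nat) : bool :=
  if w is x :: w' then
    pairwise (fun y z => ~~ (x < z < y)%N) w' && wavoids132 w'
  else true.

(* For an empty tail the default makes the test [x.+1 < x], which is false. *)
Fixpoint wbdes (w : seq nat) : nat :=
  if w is x :: w' then (((head x w').+1 < x)%N + wbdes w')%N else 0%N.

Lemma wavoids132_map_addn m w : wavoids132 (map (addn m) w) = wavoids132 w.
Proof.
elim: w => //= x w ->; rewrite pairwise_map; congr (_ && _).
by apply: eq_pairwise => y z /=; rewrite !ltn_add2l.
Qed.

Lemma wbdes_map_addn m w : wbdes (map (addn m) w) = wbdes w.
Proof.
elim: w => //= x [_|y w /= ->]; first by rewrite /= !ltnNge !leqnSn.
by rewrite -addnS ltn_add2l.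
Qed.

(** With [n] as the 3, a letter of [L] below a letter of [R] completes a 132, which forces [L] above
    [R]. Conversely, a 132 meeting both sides would need its 1 in [L] or at [n], and its 2 at [n] or
    in [R]; the maximality of [n] and [L] lying above [R] exclude this. *)
Lemma wavoids132_cat_max n L R : all (gtn n) L -> all (gtn n) R ->
  wavoids132 (L ++ n :: R) =
    [&& allrel geq L R, wavoids132 L & wavoids132 R].
Proof.
move=> ltL ltR.
(* A letter [x] dominating [R] cannot be the 1 of a pattern ending in [R]. The two alternatives
   cover a letter of [L] and [n] itself. *)
have Rmax x : all (geq x) R || (n <= x)%N ->
    pairwise (fun y z => ~~ (x < z < y)%N) R.
  move=> leR; have {}leR: all (geq x) R.
    case/orP: leR => // lenx; apply: sub_all ltR => z /= ltzn.
    exact: leq_trans (ltnW ltzn) lenx.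
  elim: (R) leR => //= z R' IHR /andP[lezx leR]; rewrite IHR // andbT.
  by apply: sub_all leR => u /= leux; rewrite ltnNge leux.
elim: L ltL => [_|x L IHL] /=; first by rewrite Rmax // leqnn orbT.
case/andP=> ltxn ltL; rewrite IHL // allrel_consl pairwise_cat /=.
have -> : all (fun z => ~~ (x < z < n)%N) R = all (geq x) R.
  apply: eq_in_all => z /(allP ltR) /= ltzn.
  by rewrite ltzn andbT -leqNgt.
have [leR|] := boolP (all (geq x) R); last by rewrite !andbF.
rewrite Rmax ?leR //= !andbT.
suff -> : allrel (fun y z => ~~ (x < z < y)%N) L (n :: R).
  by rewrite /= andbCA !andbA.
apply/allrelP => y z /(allP ltL) /= ltyn.
rewrite inE => /predU1P[->|/(allP leR) /= lezx].
  by rewrite [(n < y)%N]ltnNge (ltnW ltyn) andbF.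
by rewrite ltnNge lezx.
Qed.

Lemma wbdes_cat_max n L R : all (gtn n) L ->
  wbdes (L ++ n :: R) = (wbdes L + wbdes (n :: R))%N.
Proof.
elim: L => [//|x [|y L] IHL] /= /andP[ltx ltL].
  by rewrite !ltnNge leqnSn (leq_trans (ltnW ltx) (leqnSn n)).
by have /= -> := IHL ltL; rewrite addnA.
Qed.

(** * Decomposition of avoiding words at their maximum *)

Definition words n : seq (seq nat) :=
  [seq w <- permutations (iota 0 n) | wavoids132 w].

Lemma mem_words n w :
  (w \in words n) = wavoids132 w && perm_eq w (iota 0 n).
Proof. by rewrite mem_filter mem_permutations. Qed.

Lemma words_uniq n : uniq (words n).
Proof. by rewrite filter_uniq ?permutations_uniq. Qed.

Lemma size_word {n w} : w \in words n -> size w = n.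
Proof. by rewrite mem_words => /andP[_ /perm_size]; rewrite size_iota. Qed.

Lemma word_lt {n w} : w \in words n -> all (gtn n) w.
Proof.
rewrite mem_words => /andP[_ /perm_mem eqw]; apply/allP => x.
by rewrite eqw mem_iota.
Qed.

(** Both arguments are words on an initial segment of the naturals; the shift by [size R] lifts the
    left block above the right one. *)
Definition glue (L R : seq nat) : seq nat :=
  map (addn (size R)) L ++ (size L + size R)%N :: R.

Lemma map_addn_lt m {k L} : all (gtn k) L -> all (gtn (k + m)) (map (addn m) L).
Proof.
move=> ltL; rewrite all_map; apply: sub_all ltL => x /=.
by rewrite addnC ltn_add2r.
Qed.

Lemma glue_words {k m L R} :
  L \in words k -> R \in words m -> glue L R \in words (k + m).+1.
Proof.
move=> wL wR; have [sL sR] := (size_word wL, size_word wR).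
have [ltL ltR] := (word_lt wL, word_lt wR).
move: wL wR; rewrite !mem_words => /andP[aL pL] /andP[aR pR].
rewrite /glue sL sR wavoids132_cat_max ?map_addn_lt //; last first.
  by apply: sub_all ltR => x /= ltx; rewrite ltn_addl.
rewrite wavoids132_map_addn aL aR !andbT; apply/andP; split.
  apply/allrelP => _ z /mapP[x _ ->] /(allP ltR) /= ltz.
  by rewrite (leq_trans (ltnW ltz)) ?leq_addr.
rewrite (perm_catCA _ [:: _]) -[(k + m).+1]addn1 iotaD add0n perm_sym perm_catC.
rewrite perm_cons addnC iotaD add0n perm_catC perm_sym perm_cat //.
by rewrite -[m in iota m k]addn0 iotaDl perm_map.
Qed.

(** Cut [w] at [n]. Since [L] lies above [R], sorting each block and placing [R] first gives the
    sorted list of all letters. So [R] fills the bottom interval, and [L] becomes a word once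
    lowered by [size R]. *)
Lemma words_glue n w : w \in words n.+1 -> exists k L R,
  [/\ (k <= n)%N, L \in words k, R \in words (n - k) & w = glue L R].
Proof.
rewrite mem_words => /andP[aw pw].
have nw: n \in w by rewrite (perm_mem pw) mem_iota /= add0n.
case/splitPr: nw aw pw => L R aw pw.
have pLR: perm_eq (R ++ L) (iota 0 n).
  rewrite -(perm_cons n) -cat_cons perm_catC (perm_trans pw) //.
  by rewrite -[n.+1]addn1 iotaD add0n perm_catC.
have ltLR: all (gtn n) (R ++ L).
  by apply/allP => x; rewrite (perm_mem pLR) mem_iota.
have szLR: (size R + size L)%N = n.
  by rewrite -size_cat (perm_size pLR) size_iota.
move: ltLR aw; rewrite all_cat => /andP[ltR ltL].
rewrite wavoids132_cat_max // => /and3P[geLR aL aR].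
(* Both sides are sorted rearrangements of [iota 0 n]. *)
have eqs: sort leq R ++ sort leq L = iota 0 (size R) ++ iota (size R) (size L).
  rewrite -{2}[size R]add0n -iotaD szLR.
  apply: (sorted_eq leq_trans anti_leq).
  - rewrite (sorted_pairwise leq_trans) pairwise_cat.
    rewrite -!(sorted_pairwise leq_trans) !(sort_sorted leq_total) !andbT.
    apply/allrelP => x y; rewrite !mem_sort => xR yL.
    exact: (allrelP geLR y x yL xR).
  - exact: iota_sorted.
  - by rewrite (perm_trans _ pLR) // perm_cat // perm_sort.
have /eqP := eqs; rewrite eqseq_cat ?size_sort ?size_iota //.
case/andP=> /eqP eqR /eqP eqL.
have pR: perm_eq R (iota 0 (size R)) by rewrite -eqR perm_sym perm_sort.
have pL: perm_eq L (iota (size R) (size L)) by rewrite -eqL perm_sym perm_sort.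
have defL: L = map (addn (size R)) (map (subn^~ (size R)) L).
  rewrite -map_comp -[LHS]map_id; apply/eq_in_map => x.
  by rewrite (perm_mem pL) mem_iota /= => /andP[lex _]; rewrite subnKC.
exists (size L), (map (subn^~ (size R)) L), R.
have nkR: (n - size L)%N = size R by rewrite -szLR addnK.
split.
- by rewrite -szLR leq_addl.
- rewrite mem_words -(wavoids132_map_addn (size R)) -defL aL /=.
  rewrite (perm_trans (perm_map _ pL)) // -[in iota (size R)](addn0 (size R)).
  by rewrite iotaDl -map_comp map_id_in // => x _ /=; rewrite addKn.
- by rewrite mem_words nkR aR.
- by rewrite /glue -defL size_map addnC szLR.
Qed.

Lemma glue_inj {k m k' m' L R L' R'} :
  L \in words k -> R \in words m -> L' \in words k' -> R' \in words m' ->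
  glue L R = glue L' R' -> L = L' /\ R = R'.
Proof.
move=> wL wR wL' wR' eqg.
(* The maximum of a glued word is its size minus one, and its position is the length of the left
   block; this recovers [k] from the word. *)
have idx i j A B : A \in words i -> B \in words j ->
    index (size (glue A B)).-1 (glue A B) = i.
  move=> wA wB; rewrite /glue size_cat size_map /= addnS /= index_cat.
  rewrite ifN ?eqxx; last first.
    apply/negP => /(allP (map_addn_lt (size B) (word_lt wA))).
    by rewrite /= (size_word wA) ltnn.
  by rewrite /= eqxx addn0 size_map (size_word wA).
have ekk: k = k' by rewrite -(idx _ _ _ _ wL wR) eqg (idx _ _ _ _ wL' wR').
move/eqP: eqg.
rewrite /glue eqseq_cat ?size_map ?(size_word wL) ?(size_word wL') //.
case/andP=> eqL; rewrite eqseq_cons => /andP[_ /eqP eqR]; split=> //.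
by move: eqL; rewrite -eqR => /eqP /(inj_map (@addnI _)).
Qed.

(** [glue] is a bijection from the list [P] of admissible pairs onto [words n.+1], by [glue_words],
    [words_glue] and [glue_inj]. *)
Lemma sum_words_succ (V : nmodType) (F : seq nat -> V) n :
  \sum_(w <- words n.+1) F w =
  \sum_(0 <= k < n.+1) \sum_(L <- words k) \sum_(R <- words (n - k))
    F (glue L R).
Proof.
pose P := [seq p | k <- iota 0 n.+1,
                   p <- [seq (L, R) | L <- words k, R <- words (n - k)]].
have memP p : reflect
    (exists2 k, (k <= n)%N & p.1 \in words k /\ p.2 \in words (n - k))
    (p \in P).
  apply: (iffP allpairsPdep).
    case=> k [q [kn /allpairsP[[L R] /= [wL wR ->]] ->]].
    by exists k => //; move: kn; rewrite mem_iota.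
  case=> k kn [wL wR]; exists k, p; split; rewrite ?mem_iota //.
  by apply/allpairsP; exists p; rewrite -surjective_pairing.
have uP : uniq P.
  apply: allpairs_uniq_dep; first exact: iota_uniq.
    by move=> k _; apply: allpairs_uniq => [||[? ?] [? ?] _ _ //];
      exact: words_uniq.
  (* A pair determines its index [k], as the size of its first component. *)
  move=> u u' /allpairsPdep[k [p [_ kp ->]]] /allpairsPdep[k' [p' [_ kp' ->]]].
  move=> /= epp'; move: kp kp'; rewrite {}epp' => /allpairsP[q [qk _ ->]].
  case/allpairsP=> q' [q'k' _ [eq1 eq2]].
  by rewrite -(size_word qk) eq1 (size_word q'k').
transitivity (\sum_(w <- [seq glue p.1 p.2 | p <- P]) F w).
  apply/perm_big/uniq_perm; first exact: words_uniq.
    rewrite map_inj_in_uniq // => -[L R] [L' R'] /memP[k _ [wL wR]].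
    case/memP=> k' _ [wL' wR'] eqg.
    by have [/= -> ->] := glue_inj wL wR wL' wR' eqg.
  move=> w; apply/idP/mapP => [/words_glue[k [L [R [kn wL wR ->]]]]|].
    by exists (L, R) => //; apply/memP; exists k.
  case=> p /memP[k kn [wL wR]] ->.
  by have := glue_words wL wR; rewrite subnKC.
rewrite big_map big_allpairs_dep /index_iota subn0.
by apply: eq_bigr => k _; rewrite big_allpairs.
Qed.

(** * Recurrences for the big descent sums *)

Section Recurrence.
Context {K : comNzRingType} (t : K).

Definition bsum n : K := \sum_(w <- words n) t ^+ wbdes w.

(* Prepending the new maximum [n] creates a big descent unless the word is
   empty or already starts with [n.-1]. *)
Definition gsum n : K := \sum_(w <- words n) t ^+ wbdes (n :: w).

(** Coefficients of [B - 1], the series of nonempty blocks. *)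
Definition bpsum n : K := if n is 0 then 0 else bsum n.

(* Block lengths [k] and [n - k]; the bracket counts the right block, with a
   factor [t] for the descent into it when it is nonempty. *)
Definition conv n : K := \sum_(0 <= k < n.+1)
  bpsum k * ((n - k == 0)%N%:R + t * bpsum (n - k)).

Lemma words0 : words 0 = [:: [::]].
Proof. by []. Qed.

(** As the left block is nonempty, the maximum exceeds every letter of [R] by at least 2, so the
    step into a nonempty [R] is always a big descent. *)
Lemma wbdes_glue {k m L R} : L \in words k.+1 -> R \in words m ->
  wbdes (glue L R) = (wbdes L + (0 < m) + wbdes R)%N.
Proof.
move=> wL wR; have [sL sR] := (size_word wL, size_word wR).
have ltR := word_lt wR; rewrite /glue sL sR wbdes_cat_max; last first.
  exact: map_addn_lt _ (word_lt wL).
rewrite wbdes_map_addn -addnA; congr (_ + _)%N.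
case: R {wR} sR ltR => [<- _|y R <- /= /andP[lty _]] /=.
  by rewrite addn0 ltnNge leqnSn.
by rewrite -/(size R).+1 addSn ltnS ltn_addl.
Qed.

(** The glued word starts with a letter of the nonempty left block, which lies below [k.+1 + m]; the
    prepended letter exceeds it by at least 2. *)
Lemma wbdes_cons_glue {k m L R} : L \in words k.+1 -> R \in words m ->
  wbdes ((k.+1 + m).+1 :: glue L R) = (wbdes (glue L R)).+1.
Proof.
move=> wL wR; have := map_addn_lt m (word_lt wL).
rewrite /glue (size_word wR) /=.
case: L wL => [/size_word//|x L _] /= /andP[ltx _].
by rewrite ltnS ltx.
Qed.

Lemma wbdes_glue_nil R : wbdes (glue [::] R) = wbdes (size R :: R).
Proof. by []. Qed.

Lemma wbdes_cons_glue_nil R :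
  wbdes ((size R).+1 :: glue [::] R) = wbdes (size R :: R).
Proof. by rewrite /= ltnn. Qed.

(** Common form of the recurrences for [bsum] and [gsum]. An empty left block contributes [gsum n]
    in both; [c] is the weight of the descent from a prepended maximum into a nonempty left block,
    so it is [1] for [bsum] and [t] for [gsum]. *)
Lemma sum_first_block n (F : seq nat -> nat) (c : K) :
    (forall R, R \in words n -> F (glue [::] R) = wbdes (n :: R)) ->
    (forall k L R, (k < n)%N -> L \in words k.+1 -> R \in words (n - k.+1) ->
       t ^+ F (glue L R) = c * t ^+ wbdes (glue L R)) ->
  \sum_(w <- words n.+1) t ^+ F w = gsum n + c * conv n.
Proof.
move=> F0 FS; rewrite sum_words_succ big_nat_recl //= words0 big_seq1 subn0.
congr (_ + _).
  by apply: eq_big_seq => R /F0 ->.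
(* The term of [conv] with an empty left block vanishes because [bpsum 0] is 0. *)
rewrite /conv big_nat_recl //= mul0r add0r mulr_sumr.
apply: eq_big_nat => k /= ltkn.
rewrite /bsum mulr_suml mulr_sumr; apply: eq_big_seq => L wL.
transitivity (\sum_(R <- words (n - k.+1))
   c * (t ^+ wbdes L * (t ^+ (0 < n - k.+1)%N * t ^+ wbdes R))).
  apply: eq_big_seq => R wR.
  by rewrite (FS k) // (wbdes_glue wL wR) !exprD -!mulrA.
rewrite -!mulr_sumr; congr (_ * (_ * _)).
case: (n - k.+1)%N => [|m]; first by rewrite words0 big_seq1 mul1r mulr0 addr0.
by rewrite add0r.
Qed.

Lemma bsum_succ n : bsum n.+1 = gsum n + conv n.
Proof.
rewrite -[conv n]mul1r; apply: sum_first_block => [R wR|k L R _ _ _].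
  by rewrite wbdes_glue_nil (size_word wR).
by rewrite mul1r.
Qed.

Lemma gsum_succ n : gsum n.+1 = gsum n + t * conv n.
Proof.
apply: sum_first_block => [R wR|k L R ltkn wL wR].
  by rewrite -(size_word wR) wbdes_cons_glue_nil.
have := wbdes_cons_glue wL wR.
by rewrite subnKC // => ->; rewrite exprS.
Qed.

Lemma bsum0 : bsum 0 = 1.
Proof. by rewrite /bsum words0 big_seq1. Qed.

Lemma gsum0 : gsum 0 = 1.
Proof. by rewrite /gsum words0 big_seq1. Qed.

End Recurrence.

(** * From permutations to words *)

Lemma wavoids132P w : reflect
  (forall i j k, (i < j < k)%N -> (k < size w)%N ->
     ~~ (nth 0%N w i < nth 0%N w k < nth 0%N w j)%N)
  (wavoids132 w).
Proof.
elim: w => [|x w IHw] /=; first by left=> i j k _; rewrite ltn0.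
apply: (iffP andP) => [[/(pairwiseP 0%N) xw /IHw {}IHw]|avw].
  case=> [|i] [|j] [|k]; rewrite ?andbF //= !ltnS.
    by move=> ltjk ltk; apply: xw => //; apply: ltn_trans ltjk ltk.
  exact: IHw.
split; first apply/(pairwiseP 0%N) => j k _ ltk ltjk.
  exact: (avw 0 j.+1 k.+1).
by apply/IHw => i j k ltijk ltk; apply: (avw i.+1 j.+1 k.+1).
Qed.

(** The guard on [i.+1] matters: at the last position the default value 0 of [nth] could create a
    spurious big descent. *)
Lemma wbdes_sum w : wbdes w = (\sum_(i < size w)
  ((i.+1 < size w) && ((nth 0 w i.+1).+1 < nth 0 w i)))%N.
Proof.
elim: w => [|x w IHw] /=; first by rewrite big_ord0.
rewrite big_ord_recl /= IHw; congr addn.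
by case: w {IHw} => //=; rewrite ltnNge leqnSn.
Qed.

Definition word_of {n} (s : 'S_n) : seq nat := [seq val (s i) | i <- enum 'I_n].

Lemma size_word_of n (s : 'S_n) : size (word_of s) = n.
Proof. by rewrite size_map size_enum_ord. Qed.

Lemma nth_word_of n (s : 'S_n) (i : 'I_n) : nth 0%N (word_of s) i = s i.
Proof. by rewrite (nth_map i) ?size_enum_ord // nth_ord_enum. Qed.

Lemma avoids132_word n (s : 'S_n) : avoids132 s = wavoids132 (word_of s).
Proof.
apply/idP/wavoids132P => [av i j k ltijk|av].
  rewrite size_word_of => ltk; have /andP[ltij ltjk] := ltijk.
  have ltj := ltn_trans ltjk ltk; have lti := ltn_trans ltij ltj.
  have -> : i = Ordinal lti by []; have -> : j = Ordinal ltj by [].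
  have -> : k = Ordinal ltk by [].
  rewrite !nth_word_of; apply: contra av => pat.
  apply/existsP; exists (Ordinal lti); apply/existsP; exists (Ordinal ltj).
  by apply/existsP; exists (Ordinal ltk); rewrite ltijk.
apply/negP => /existsP[i /existsP[j /existsP[k /andP[ltijk pat]]]].
have := av i j k ltijk; rewrite size_word_of ltn_ord => /(_ isT).
by rewrite !nth_word_of pat.
Qed.

Lemma bdes_word n (s : 'S_n) : bdes s = wbdes (word_of s).
Proof.
rewrite wbdes_sum size_word_of /bdes -sum1dep_card big_mkcond /=.
apply: eq_bigr => k _; rewrite -[if _ then _ else _]/(nat_of_bool _).
congr nat_of_bool; rewrite nth_word_of; apply/existsP/andP.
  case=> k' /andP[/eqP <- pat]; split; first exact: ltn_ord.
  by rewrite nth_word_of.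
case=> ltk; have -> : k.+1 = Ordinal ltk by [].
by rewrite nth_word_of => pat; exists (Ordinal ltk); rewrite eqxx.
Qed.

Lemma perm_word_of n :
  perm_eq [seq word_of s | s : 'S_n] (permutations (iota 0 n)).
Proof.
have uS : uniq [seq word_of s | s : 'S_n].
  rewrite map_inj_uniq ?enum_uniq // => s s' eqw; apply/permP => i.
  by apply: val_inj; rewrite /= -!nth_word_of eqw.
have sub : {subset [seq word_of s | s : 'S_n] <= permutations (iota 0 n)}.
  move=> _ /imageP[s _ ->]; rewrite mem_permutations -val_enum_ord.
  rewrite /word_of (map_comp val s) perm_map //; apply: uniq_perm.
  - by rewrite (map_inj_uniq perm_inj) enum_uniq.
  - exact: enum_uniq.
  move=> i; rewrite mem_enum; apply/mapP; exists ((s^-1)%g i).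
    by rewrite mem_enum.
  by rewrite permKV.
(* Both lists are duplicate-free and have n! elements, so one inclusion gives equality. *)
have [|_ eqm] := uniq_min_size uS sub.
  by rewrite size_permutations ?iota_uniq // size_image size_iota card_Sn.
by rewrite uniq_perm ?permutations_uniq.
Qed.

Lemma sum_avoids132 (K : comNzRingType) (t : K) n :
  \sum_(s : 'S_n | avoids132 s) t ^+ bdes s = bsum t n.
Proof.
rewrite /bsum /words big_filter -(perm_big _ (perm_word_of n)) /=.
rewrite big_image_cond.
apply: eq_big => [s|s _]; last by rewrite bdes_word.
by rewrite avoids132_word.
Qed.

(** * Functional equations and the quadratic for the generating function *)

Section Series.
Variable K : comNzRingType.
Implicit Types f : fps K.

Lemma fps_coefCM (c : K) f n : (fpsC c * f) n = c * f n.
Proof.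
rewrite fps_coefM big_ord_recl subn0 big1 ?addr0 // => i _.
by rewrite /= mul0r.
Qed.

Lemma fps_coefXM f n : (fpsX K * f) n = if n is m.+1 then f m else 0.
Proof.
rewrite fps_coefM; case: n => [|n]; first by rewrite big_ord1 /= mul0r.
rewrite big_ord_recl mul0r add0r big_ord_recl /= subSS subn0 mul1r.
by rewrite big1 ?addr0 // => i _; rewrite mul0r.
Qed.

End Series.

Section Quadratic.
Variables (K : comNzRingType) (q : K).
Let t : fps K := fpsC q.
Let x : fps K := fpsX K.
Let B : fps K := Fps (bsum q).
Let G : fps K := Fps (gsum q).

Let coefB1 n : (B - 1) n = bpsum q n.
Proof.
rewrite fps_coefB fps_coef1; case: n => [|n] /=; last by rewrite subr0.
by rewrite bsum0 subrr.
Qed.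

Let conv_coef n : ((B - 1) * (1 + t * (B - 1))) n = conv q n.
Proof.
rewrite fps_coefM /conv big_mkord; apply: eq_bigr => i _.
by rewrite coefB1 fps_coefD fps_coef1 fps_coefCM coefB1.
Qed.

Let B_eq : B = 1 + x * (G + (B - 1) * (1 + t * (B - 1))).
Proof.
apply/fpsP => n; rewrite fps_coefD fps_coef1 fps_coefXM.
case: n => [|n]; first by rewrite addr0 /= bsum0.
by rewrite add0r fps_coefD conv_coef /= bsum_succ.
Qed.

Let G_eq : G = 1 + x * (G + t * ((B - 1) * (1 + t * (B - 1)))).
Proof.
apply/fpsP => n; rewrite fps_coefD fps_coef1 fps_coefXM.
case: n => [|n]; first by rewrite addr0 /= gsum0.
by rewrite add0r fps_coefD fps_coefCM conv_coef /= gsum_succ.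
Qed.

Lemma bsum_quadratic :
  t * x * (1 - (1 - t) * x) * B ^+ 2
  = (1 - 2 * (1 - t) * x + (1 - t) * (1 - 2 * t) * x ^+ 2) * B
    - (1 - (1 - t) * x + (1 - t) ^+ 2 * x ^+ 2).
Proof.
set S := (B - 1) * (1 + t * (B - 1)).
have eB : B - (1 + x * (G + S)) = 0 by rewrite {1}B_eq subrr.
have eG : G - (1 + x * (G + t * S)) = 0 by rewrite {1}G_eq subrr.
apply/eqP; rewrite -subr_eq0; apply/eqP.
(* Elimination of [G]: the first multiplier is [-(1 - x)], so [G] gets the coefficients [x(1 - x)]
   and [-x(1 - x)], which cancel. *)
transitivity (- (1 - (1 - t) * x - x * t) * (B - (1 + x * (G + S)))
              - x * (G - (1 + x * (G + t * S)))).
  by rewrite /S; ring.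
by rewrite eB eG !mulr0 subr0.
Qed.

End Quadratic.

Theorem theorem2p1 :
  let t : fps Qt := fpsC Qt_t in
  let x : fps Qt := fpsX Qt in
  tofrac B132 =
    tofrac (1 - 2 * (1 - t) * x + (1 - t) * (1 - 2 * t) * x ^+ 2
            - fps_sqrt (1 - 4 * x + 6 * (1 - t) * x ^+ 2
                        - 4 * (1 - t) ^+ 2 * x ^+ 3
                        + (1 - t) ^+ 2 * x ^+ 4))
    / tofrac (2 * t * x * (1 - (1 - t) * x))
    :> {fraction (fps Qt)}.
Proof.
move=> t x.
have two_neq0 : 2%:R != 0 :> Qt.
  rewrite -(rmorph_nat (@tofrac {poly rat})) tofrac_eq0.
  by rewrite -(rmorph_nat (@polyC rat)) polyC_eq0.
have x00 : x 0%N = 0 by [].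
have quad := bsum_quadratic Qt Qt_t; rewrite -/t -/x in quad.
have -> : B132 = Fps (bsum Qt_t).
  by apply/fpsP => n; apply: sum_avoids132.
set B := Fps _ in quad *.
set P := 1 - 2 * (1 - t) * x + (1 - t) * (1 - 2 * t) * x ^+ 2 in quad *.
set D := 1 - (1 - t) * x in quad *.
have D0 : D 0%N = 1.
  by rewrite /D fps_coefB fps_coef0M fps_coef1 x00 mulr0 subr0.
have denom_neq0 : 2 * t * x * D != 0.
  rewrite !mulf_neq0 //; apply/eqP => /fpsP.
  - by move/(_ 0%N)/eqP; rewrite fps_coefD fps_coef1 -mulr2n (negPf two_neq0).
  - by move/(_ 0%N)/eqP; rewrite /= tofrac_eq0 polyX_eq0.
  - by move/(_ 1%N)/eqP; rewrite /= oner_eq0.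
  - by move/(_ 0%N)/eqP; rewrite D0 oner_eq0.
(* This is the quadratic formula solved for the root. The constant term 1 comes from [P], the other
   summand being divisible by [x], and it selects the sign. *)
have -> : fps_sqrt (1 - 4 * x + 6 * (1 - t) * x ^+ 2
    - 4 * (1 - t) ^+ 2 * x ^+ 3 + (1 - t) ^+ 2 * x ^+ 4)
    = P - 2 * t * x * D * B.
  apply: (fps_sqrt_uniq two_neq0).
    rewrite fps_coefB /P fps_coefD fps_coefB fps_coef1 expr2.
    by rewrite !fps_coef0M x00 !(mulr0, mul0r) addr0 !subr0.
  (* By [quad], the last factor is the free term of the quadratic, so the square is its
     discriminant, which expands to the radicand. *)
  transitivity (P ^+ 2 - 4 * (t * x * D) * (P * B - t * x * D * B ^+ 2)).
    by ring.
  by rewrite quad /P /D; ring.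
by rewrite subKr tofracM mulrAC divff ?mul1r // tofrac_eq0.
Qed.
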